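(* MALA with $\theta=1/2$ (non-preconditioned, Crank-Nicolson proposal, time step size $\Delta t$, target density $\pi$) is an HMC algorithm, i.e. one step $\boldsymbol{u}^0\mapsto\boldsymbol{u}^1$ of MALA is equal in law to one step $\boldsymbol{u}^0\mapsto\boldsymbol{u}^1$ of the HMC algorithm, with (i) the extended density on $\mathbb{R}^{d(n-1)}\times\mathbb{R}^{d(n-1)}$ defined by $$\nu_{\mathrm{extended}}(\boldsymbol{u},\boldsymbol{p})=Z^{-1}\exp\left(-\frac{\beta}{2}\Delta s\,H(\boldsymbol{u},\boldsymbol{p})\right),$$ where $Z$ is a normalization constant, $H$ is the Hamiltonian function $$H(\boldsymbol{u},\boldsymbol{p})=\tfrac12\|\boldsymbol{p}\|^2-\tfrac12\boldsymbol{u}\cdot\boldsymbol{L}\boldsymbol{u}+\mathcal{G}(\boldsymbol{u}),$$ and $\mathcal{G}(\boldsymbol{u})=\sum_{i=1}^{n-1}G(\boldsymbol{u}_i+\psi(s_i))$ for $\boldsymbol{u}=(\boldsymbol{u}_1,\dots,\boldsymbol{u}_{n-1})\in\mathbb{R}^{d(n-1)}$; (ii) the volume-preserving and reversible map $\varphi_{\Delta\tau}:(\boldsymbol{u}^0,\boldsymbol{p}^0)\mapsto(\boldsymbol{u}^1,\boldsymbol{p}^1)$ defined by $$\boldsymbol{u}^1=\left(\boldsymbol{I}-\tfrac{\Delta\tau^2}{4}\boldsymbol{L}\right)^{-1}\left(\left(\boldsymbol{I}+\tfrac{\Delta\tau^2}{4}\boldsymbol{L}\right)\boldsymbol{u}^0+\Delta\tau\,\boldsymbol{p}^0-\tfrac{\Delta\tau^2}{2}\nabla\mathcal{G}(\boldsymbol{u}^0)\right),$$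 $$\boldsymbol{p}^1=\left(\boldsymbol{I}-\tfrac{\Delta\tau^2}{4}\boldsymbol{L}\right)^{-1}\left(\left(\boldsymbol{I}+\tfrac{\Delta\tau^2}{4}\boldsymbol{L}\right)\left(\boldsymbol{p}^0-\tfrac{\Delta\tau}{2}\nabla\mathcal{G}(\boldsymbol{u}^0)\right)+\Delta\tau\,\boldsymbol{L}\boldsymbol{u}^0\right)-\tfrac{\Delta\tau}{2}\nabla\mathcal{G}(\boldsymbol{u}^1),$$ with $\Delta\tau=\sqrt{2\Delta t}$.
   Context: Setting. Let $d\ge1$, $\beta>0$, $S>0$, $x^-,x^+\in\mathbb{R}^d$, $n\ge2$ an integer, $\Delta s=S/n$, $s_i=i\Delta s$, $\Delta t>0$. Let $V:\mathbb{R}^d\to\mathbb{R}$ be a (sufficiently smooth) potential energy function, $G(x)=\frac12|\nabla V(x)|^2-\beta^{-1}\Delta V(x)$ (here $\Delta V$ is the Laplacian of $V$), and $\psi(s)=x^-\frac{S-s}{S}+x^+\frac{s}{S}$. $\boldsymbol{L}$ is the $d(n-1)\times d(n-1)$ symmetric matrix with $\boldsymbol{L}_{ij}=-2/\Delta s^2$ if $i=j$, $\boldsymbol{L}_{ij}=1/\Delta s^2$ if $|i-j|=d$, and $0$ otherwise; $\boldsymbol{I}$ is the identity matrix. Vectors $\boldsymbol{u}\in\mathbb{R}^{d(n-1)}$ are written $\boldsymbol{u}=(\boldsymbol{u}_1,\dots,\boldsymbol{u}_{n-1})$ with $\boldsymbol{u}_i\in\mathbb{R}^d$, and $\boldsymbol{F}(\boldsymbol{u})=\left(-\nabla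 G(\boldsymbol{u}_1+\psi(s_1)),\dots,-\nabla G(\boldsymbol{u}_{n-1}+\psi(s_{n-1}))\right)$. The (non-normalized) target density on $\mathbb{R}^{d(n-1)}$ is $$\pi(\boldsymbol{u})=\exp\left(-\frac{\beta}{2}\Delta s\left(\sum_{i=1}^{n-1}G(\boldsymbol{u}_i+\psi(s_i))-\tfrac12\boldsymbol{u}^{\mathrm T}\boldsymbol{L}\boldsymbol{u}\right)\right).$$ MALA with parameter $\theta\in[0,1]$. Let $\boldsymbol{A}_\theta=\boldsymbol{I}-\theta\Delta t\boldsymbol{L}$, $\boldsymbol{B}_\theta=\boldsymbol{I}+(1-\theta)\Delta t\boldsymbol{L}$. Given $\boldsymbol{u}^0$: (Step 1) compute the proposal $\tilde{\boldsymbol{u}}^1$ from $\boldsymbol{A}_\theta\tilde{\boldsymbol{u}}^1=\boldsymbol{B}_\theta\boldsymbol{u}^0+\Delta t\,\boldsymbol{F}(\boldsymbol{u}^0)+2\sqrt{\beta^{-1}}\sqrt{\Delta t/\Delta s}\,\boldsymbol{\xi}^0$ with $\boldsymbol{\xi}^0$ a standard normal vector in $\mathbb{R}^{d(n-1)}$; (Step 2) set $\boldsymbol{u}^1=\tilde{\boldsymbol{u}}^1$ with probability $\alpha(\boldsymbol{u}^0,\tilde{\boldsymbol{u}}^1)$ and $\boldsymbol{u}^1=\boldsymbol{u}^0$ otherwise, where $$\alpha(\boldsymbol{u},\boldsymbol{u}')=\min\left(1,\frac{q(\boldsymbol{u}',\boldsymbol{u})\pi(\boldsymbol{u}')}{q(\boldsymbol{u},\boldsymbol{u}')\pi(\boldsymbol{u})}\right)$$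 and $q$ is the transition density of the proposal, which up to a constant factor not depending on $\boldsymbol{u},\boldsymbol{u}'$ (and cancelling in $\alpha$) is $q(\boldsymbol{u},\boldsymbol{u}')\propto\exp\left(-\frac{\beta\Delta s}{8\Delta t}|\boldsymbol{A}_\theta\boldsymbol{u}'-\boldsymbol{B}_\theta\boldsymbol{u}-\Delta t\boldsymbol{F}(\boldsymbol{u})|^2\right)$. HMC algorithm with extended density $\nu_{\mathrm{extended}}$ and volume-preserving reversible map $\varphi$. Given $\boldsymbol{u}^0$: (Step 1) draw $\boldsymbol{p}^0$ from the measure (proportional to) $\nu_{\mathrm{extended}}(\boldsymbol{u}^0,\boldsymbol{p})\,d\boldsymbol{p}$; (Step 2) set $(\tilde{\boldsymbol{u}}^1,\tilde{\boldsymbol{p}}^1)=\varphi(\boldsymbol{u}^0,\boldsymbol{p}^0)$; (Step 3) set $\boldsymbol{u}^1=\tilde{\boldsymbol{u}}^1$ with probability $\min\left(1,\nu_{\mathrm{extended}}(\tilde{\boldsymbol{u}}^1,\tilde{\boldsymbol{p}}^1)/\nu_{\mathrm{extended}}(\boldsymbol{u}^0,\boldsymbol{p}^0)\right)$ and $\boldsymbol{u}^1=\boldsymbol{u}^0$ otherwise. A map $\varphi$ is volume-preserving if $|\det D\varphi|=1$, and reversible if $\varphi\circ\rho\circ\varphi=\rho$ where $\rho(\boldsymbol{u},\boldsymbol{p})=(\boldsymbol{u},-\boldsymbol{p})$. *)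

(* Defs.v *)
From HB Require Import structures.
From mathcomp Require Import all_boot all_order all_algebra.
From mathcomp Require Import all_classical all_reals all_analysis.
Set Implicit Arguments.
Unset Strict Implicit.
Unset Printing Implicit Defensive.
Import Order.TTheory GRing.Theory Num.Theory.
Import numFieldNormedType.Exports.
Local Open Scope classical_set_scope.
Local Open Scope ring_scope.

(* The Borel sigma-algebra of R^n, generated by the coordinate functions. *)
Section measurable_rV.
Context {R : realType} (n : nat).

Let coors : 'I_n -> 'rV[R]_n -> R := fun i v => v 0 i.

Let rV_set0 : g_sigma_preimage coors set0.
Proof. exact: sigma_algebra0. Qed.

Let rV_setC A : g_sigma_preimage coors A -> g_sigma_preimage coors (~` A).
Proof. exact: sigma_algebraC. Qed.

Let rV_bigcup (F : (set 'rV[R]_n)^nat) :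
  (forall i, g_sigma_preimage coors (F i)) ->
  g_sigma_preimage coors (\bigcup_i (F i)).
Proof. exact: sigma_algebra_bigcup. Qed.

HB.instance Definition _ :=
  @isMeasurable.Build (measure_tuple_display default_measure_display)
  'rV[R]_n (g_sigma_preimage coors) rV_set0 rV_setC rV_bigcup.

End measurable_rV.

Section lebesgue_rV.
Context {R : realType}.

Lemma measurable_coord n (i : 'I_n) :
  measurable_fun [set: 'rV[R]_n] (fun v => v 0 i).
Proof.
move=> _ Y mY; rewrite setTI; apply: sub_sigma_algebra => /=.
rewrite -bigcup_seq/=; exists i => /=; first by rewrite mem_index_enum.
by exists Y => //; rewrite setTI.
Qed.

Lemma measurable_fun_coordP d (T : measurableType d) n (f : T -> 'rV[R]_n) :
  (forall i, measurable_fun [set: T] (fun t => f t 0 i)) ->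
  measurable_fun [set: T] f.
Proof.
move=> mf _ A mA; rewrite setTI.
suff : @measurable _ 'rV[R]_n `<=` [set B | measurable (f @^-1` B)] by exact.
apply: smallest_sub.
  split => /=.
  - by rewrite preimage_set0.
  - by move=> B mB; rewrite setTD preimage_setC; exact: measurableC.
  - by move=> F mF; rewrite preimage_bigcup; exact: bigcup_measurable.
rewrite -bigcup_seq; apply: bigcup_sub => i _ _ [B mB <-] /=.
by rewrite setTI; have := mf i measurableT B mB; rewrite setTI.
Qed.

(* Identification of R x R^n with R^(n+1). *)
Definition rVcons n (z : R * 'rV[R]_n) : 'rV[R]_n.+1 := row_mx z.1%:M z.2.

Definition rVhead_behead n (v : 'rV[R]_n.+1) : R * 'rV[R]_n :=
  (v 0 0, \row_i v 0 (lift 0 i)).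

Lemma rVconsE0 n (z : R * 'rV[R]_n) : rVcons z 0 0 = z.1.
Proof.
rewrite mxE; case: splitP => [j _|k /eqP]; last by [].
by rewrite mxE !ord1 eqxx.
Qed.

Lemma rVconsES n (z : R * 'rV[R]_n) i : rVcons z 0 (lift 0 i) = z.2 0 i.
Proof.
rewrite mxE; case: splitP => [j|k]; first by rewrite ord1.
by rewrite lift0 add1n => -[/val_inj ->].
Qed.

Lemma rVconsK n : cancel (@rVcons n) (@rVhead_behead n).
Proof.
case=> x v; rewrite /rVhead_behead rVconsE0/=; congr pair.
by apply/rowP => i; rewrite mxE rVconsES.
Qed.

Lemma measurable_rVcons n : measurable_fun setT (@rVcons n).
Proof.
apply: measurable_fun_coordP => i; case: (unliftP 0 i) => [j|] ->.
  rewrite [X in measurable_fun _ X](_ : _ = (fun v : 'rV[R]_n => v 0 j) \o snd).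
    by apply: measurableT_comp => //; exact: measurable_coord.
  by apply/funext => z /=; rewrite rVconsES.
rewrite [X in measurable_fun _ X](_ : _ = fst)//.
by apply/funext => z /=; rewrite rVconsE0.
Qed.

Lemma measurable_rVhead_behead n : measurable_fun setT (@rVhead_behead n).
Proof.
apply: measurable_fun_pair; first exact: measurable_coord.
apply: measurable_fun_coordP => i.
rewrite [X in measurable_fun _ X](_ : _ = fun v : 'rV[R]_n.+1 => v 0 (lift 0 i)).
  exact: measurable_coord.
by apply/funext => v; rewrite mxE.
Qed.

Section step.
Variables (n : nat) (mu : {sigma_finite_measure set 'rV[R]_n -> \bar R}).

Definition lebesgue_rV_step : set 'rV[R]_n.+1 -> \bar R :=
  pushforward (lebesgue_measure \x mu)%E (@rVcons n).

Let step0 : lebesgue_rV_step set0 = 0%E.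
Proof. by rewrite /lebesgue_rV_step /pushforward preimage_set0 measure0. Qed.

Let step_ge0 A : (0 <= lebesgue_rV_step A)%E.
Proof. by rewrite /lebesgue_rV_step /pushforward measure_ge0. Qed.

Let step_sigma_additive : semi_sigma_additive lebesgue_rV_step.
Proof.
move=> F mF tF mUF; rewrite /lebesgue_rV_step /pushforward preimage_bigcup.
have mc A : measurable A -> measurable (@rVcons n @^-1` A).
  by move=> mA; rewrite -[X in measurable X]setTI; exact: measurable_rVcons.
apply: measure_semi_sigma_additive.
- by move=> k; exact: mc.
- apply/trivIsetP => /= i j _ _ ij; rewrite -preimage_setI.
  by move/trivIsetP : tF => /(_ _ _ _ _ ij) ->//; rewrite preimage_set0.
- by rewrite -preimage_bigcup; exact: mc.
Qed.

HB.instance Definition _ := isMeasure.Build _ _ _ lebesgue_rV_step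
  step0 step_ge0 step_sigma_additive.

Let step_sigma_finite : sigma_finite setT lebesgue_rV_step.
Proof.
have /sigma_finiteP[F [TF ndF Foo]] :=
  sigma_finiteT (@lebesgue_measure R).
have /sigma_finiteP[G [TG ndG Goo]] := sigma_finiteT mu.
exists (fun k => @rVhead_behead n @^-1` (F k `*` G k)).
  rewrite -preimage_bigcup -[LHS](preimage_setT (@rVhead_behead n)).
  congr (_ @^-1` _); rewrite -setXTT TF TG predeqE => -[x y]; split.
    move=> [/= [k _ Fkx] [l _ Gly]]; exists (maxn k l) => //; split.
    - by move: x Fkx; exact/subsetPset/ndF/leq_maxl.
    - by move: y Gly; exact/subsetPset/ndG/leq_maxr.
  by move=> [k _ []/= ? ?]; split; exists k.
move=> k; have [mF Fk] := Foo k; have [mG Gk] := Goo k; split.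
  rewrite -[X in measurable X]setTI.
  by apply: measurable_rVhead_behead => //; exact: measurableX.
rewrite /lebesgue_rV_step /pushforward -comp_preimage.
rewrite (_ : _ \o _ = id); last by apply/funext => z /=; rewrite rVconsK.
by rewrite preimage_id product_measure1E// lte_mul_pinfty// ge0_fin_numE.
Qed.

HB.instance Definition _ := Measure_isSigmaFinite.Build _ _ _ lebesgue_rV_step
  step_sigma_finite.

End step.

(* Lebesgue measure on R^n: the iterated product of lebesgue_measure. *)
Fixpoint lebesgue_rV (n : nat) : {sigma_finite_measure set 'rV[R]_n -> \bar R} :=
  match n with
  | 0 => dirac (0 : 'rV[R]_0)
  | n'.+1 => lebesgue_rV_step (lebesgue_rV n')
  end.

Lemma lebesgue_rV_box n (A : 'I_n -> set R) :
  (forall i, measurable (A i)) ->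
  lebesgue_rV n [set v | forall i, A i (v 0 i)] =
  (\prod_(i < n) lebesgue_measure (A i))%E.
Proof.
elim: n A => [|n IH] A mA.
  by rewrite big_ord0 /= diracE mem_set//= => -[].
rewrite big_ord_recl.
set X := [set v | _]; set Y := [set v : 'rV[R]_n | forall i, A (lift ord0 i) (v 0 i)].
transitivity ((lebesgue_measure \x lebesgue_rV n)%E (A ord0 `*` Y)).
  congr (product_measure1 _ _ _).
  apply/seteqP; split => [z /= h|z /= [h0 hS] i].
    by split => [|i]; [rewrite -rVconsE0|rewrite -rVconsES].
  by case: (unliftP ord0 i) => [j|] ->; rewrite ?rVconsES ?rVconsE0.
have mY : measurable Y.
  rewrite (_ : Y = \bigcap_(i in [set: 'I_n])
      ((fun v : 'rV[R]_n => v 0 i) @^-1` A (lift ord0 i))).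
    apply: fin_bigcap_measurable => // i _.
    by rewrite -[X in measurable X]setTI; exact: measurable_coord.
  by apply/seteqP; split => [v h i _|v h i]; [exact: h|exact: (h i)].
have -> : (lebesgue_measure \x lebesgue_rV n)%E (A ord0 `*` Y) =
    (lebesgue_measure (A ord0) * lebesgue_rV n Y)%E.
  by apply: product_measure1E => //; exact: mA.
by congr (_ * _)%E; exact: (IH (fun i => A (lift ord0 i))).
Qed.

End lebesgue_rV.

Section vector_calculus.
Context {R : realType}.

(* The library norm on matrices is the sup norm, so Euclidean norms are written
   with this inner product. *)
Definition dotv n (u v : 'rV[R]_n) : R := \sum_(i < n) u 0 i * v 0 i.

(* Vectors of R^n are row vectors, as the library's jacobian requires; this is
   the usual product M u of a matrix and a column vector. *)
Definition mulmv n (M : 'M[R]_n) (u : 'rV[R]_n) : 'rV[R]_n := u *m M^T.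

Definition partial n (i : 'I_n) (f : 'rV[R]_n -> R) : 'rV[R]_n -> R :=
  fun x => 'D_(delta_mx 0 i) f x.

Definition grad n (f : 'rV[R]_n -> R) (x : 'rV[R]_n) : 'rV[R]_n :=
  \row_(i < n) partial i f x.

Definition laplacian n (f : 'rV[R]_n -> R) (x : 'rV[R]_n) : R :=
  \sum_(i < n) partial i (partial i f) x.

Fixpoint continuously_differentiable n (k : nat) (f : 'rV[R]_n -> R) : Prop :=
  match k with
  | 0 => continuous f
  | k'.+1 => (forall x, differentiable f x) /\
             (forall i, continuously_differentiable k' (@partial n i f))
  end.

End vector_calculus.

(* A vector of R^(d m) as m consecutive blocks of R^d: entry k of block i has
   index i d + k. *)
Section blocks.
Context {R : realType} {d m : nat}.

Lemma block_index_subproof (i : 'I_m) (k : 'I_d) : (i * d + k < d * m)%N.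
Proof.
apply: (@leq_trans (i.+1 * d)); first by rewrite mulSn addnC ltn_add2r.
by rewrite mulnC leq_mul2l ltn_ord orbT.
Qed.

Definition block_index (i : 'I_m) (k : 'I_d) : 'I_(d * m) :=
  Ordinal (block_index_subproof i k).

Definition block (u : 'rV[R]_(d * m)) (i : 'I_m) : 'rV[R]_d :=
  \row_(k < d) u 0 (block_index i k).

Lemma block_of_index_subproof (j : 'I_(d * m)) : (j %/ d < m)%N.
Proof.
case: d j => [[j]|d' j]; first by rewrite mul0n.
by rewrite ltn_divLR// [X in (_ < X)%N]mulnC; case: j => j lj; exact: lj.
Qed.

Lemma pos_of_index_subproof (j : 'I_(d * m)) : (j %% d < d)%N.
Proof. by case: d j => [[j]|d' j]; [rewrite mul0n|rewrite ltn_mod]. Qed.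

Definition of_blocks (b : 'I_m -> 'rV[R]_d) : 'rV[R]_(d * m) :=
  \row_(j < d * m) b (Ordinal (block_of_index_subproof j)) 0
                     (Ordinal (pos_of_index_subproof j)).

Lemma of_blocksK b i : block (of_blocks b) i = b i.
Proof.
apply/rowP => k; rewrite !mxE; congr (b _ 0 _); apply/val_inj => /=.
  by rewrite divnMDl ?(leq_trans _ (ltn_ord k))// divn_small ?addn0.
by rewrite modnMDl modn_small.
Qed.

End blocks.

Section probability.
Context {R : realType} {dT : measure_display} {T : measurableType dT}.
Variable P : probability T R.

Definition independent_rv d1 d2 (T1 : measurableType d1)
    (T2 : measurableType d2) (X : {RV P >-> T1}) (Y : {RV P >-> T2}) : Prop :=
  forall A B, measurable A -> measurable B ->
    P (X @^-1` A `&` Y @^-1` B) = (P (X @^-1` A) * P (Y @^-1` B))%E.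

Definition uniform01_rv (U : {RV P >-> R}) : Prop :=
  forall B : set R, measurable B ->
    distribution P U B = uniform_prob (@ltr01 R) B.

(* The coordinates are mutually independent with law N(0, 1). *)
Definition standard_normal_rv n (xi : {RV P >-> 'rV[R]_n}) : Prop :=
  forall B : 'I_n -> set R, (forall i, measurable (B i)) ->
    distribution P xi [set v | forall i, B i (v 0 i)] =
    (\prod_(i < n) normal_prob (0 : R) 1 (B i))%E.

End probability.

Section hmc.
Context {R : realType} {N : nat}.
Local Notation X := 'rV[R]_N.

Definition flat_map (phi : X * X -> X * X) (z : 'rV[R]_(N + N)) :
    'rV[R]_(N + N) :=
  let w := phi (lsubmx z, rsubmx z) in row_mx w.1 w.2.

Definition volume_preserving (phi : X * X -> X * X) : Prop :=
  forall z, differentiable (flat_map phi) z /\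
    `| \det ('J (flat_map phi) z) | = 1.

Definition momentum_flip (z : X * X) : X * X := (z.1, - z.2).

Definition reversible (phi : X * X -> X * X) : Prop :=
  phi \o momentum_flip \o phi =1 momentum_flip.

(* A density with infinite integral has no normalization constant: any Z > 0 is
   then accepted. *)
Definition is_normalization_constant (f : X * X -> R) (Z : R) : Prop :=
  0 < Z /\
  let I := (\int[(@lebesgue_rV R N \x @lebesgue_rV R N)%E]_z (f z)%:E)%E in
  ((I < +oo)%E -> I = Z%:E).

(* u1 is the result of one HMC step from u0: the momentum p0 is drawn from the
   probability proportional to nu(u0, p) dp, and the move is accepted when an
   independent uniform variable is at most the acceptance probability. *)
Definition hmc_step (nu : X * X -> R) (phi : X * X -> X * X)
    (dT : measure_display) (T : measurableType dT) (P : probability T R)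
    (u0 : X) (u1 : {RV P >-> X}) : Prop :=
  exists (p0 : {RV P >-> X}) (U : {RV P >-> R}),
  [/\ exists c : R, forall E : set X, measurable E ->
        distribution P p0 E =
        (c%:E * \int[@lebesgue_rV R N]_(p in E) (nu (u0, p))%:E)%E,
      uniform01_rv U,
      independent_rv p0 U &
      forall w, let z := phi (u0, p0 w) in
        u1 w = if U w <= Num.min 1 (nu z / nu (u0, p0 w)) then z.1 else u0].

End hmc.

Section transition_path.
Context {R : realType} {d : nat}.
Variables (n : nat) (beta S : R) (xm xp : 'rV[R]_d) (V : 'rV[R]_d -> R).
Local Notation X := 'rV[R]_(d * n.-1).

Definition ds : R := S / n%:R.

Definition psi (s : R) : 'rV[R]_d := ((S - s) / S) *: xm + (s / S) *: xp.

Definition G (x : 'rV[R]_d) : R :=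
  2^-1 * dotv (grad V x) (grad V x) - beta^-1 * laplacian V x.

(* Blocks are numbered from 0, so block i sits at the node s_(i+1). *)
Definition path_point (u : X) (i : 'I_n.-1) : 'rV[R]_d :=
  block u i + psi (i.+1%:R * ds).

Definition calG (u : X) : R := \sum_(i < n.-1) G (path_point u i).

Definition F (u : X) : X := of_blocks (fun i => - grad G (path_point u i)).

Definition L : 'M[R]_(d * n.-1) :=
  \matrix_(i, j) if i == j then - 2 / ds ^+ 2
                 else if (`|i - j| == d)%N then 1 / ds ^+ 2 else 0.

Definition target_density (u : X) : R :=
  expR (- (beta / 2) * ds * (calG u - 2^-1 * dotv u (mulmv L u))).

Section mala.
Variables (dt theta : R).

Definition mala_A : 'M[R]_(d * n.-1) := 1%:M - (theta * dt) *: L.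

Definition mala_B : 'M[R]_(d * n.-1) := 1%:M + ((1 - theta) * dt) *: L.

(* Transition density of the proposal, up to its constant factor. *)
Definition mala_q (u u' : X) : R :=
  let r := mulmv mala_A u' - mulmv mala_B u - dt *: F u in
  expR (- (beta * ds / (8 * dt)) * dotv r r).

Definition mala_alpha (u u' : X) : R :=
  Num.min 1 ((mala_q u' u * target_density u') /
             (mala_q u u' * target_density u)).

Definition mala_step (dT : measure_display) (T : measurableType dT)
    (P : probability T R) (u0 : X) (u1 : {RV P >-> X}) : Prop :=
  exists (xi : {RV P >-> X}) (U : {RV P >-> R}) (ut : T -> X),
  [/\ standard_normal_rv xi, uniform01_rv U, independent_rv xi U,
      (forall w, mulmv mala_A (ut w) =
        mulmv mala_B u0 + dt *: F u0
        + (2 * Num.sqrt beta^-1 * Num.sqrt (dt / ds)) *: xi w) &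
      (forall w, u1 w = if U w <= mala_alpha u0 (ut w) then ut w else u0)].

End mala.

Definition hamiltonian (z : X * X) : R :=
  2^-1 * dotv z.2 z.2 - 2^-1 * dotv z.1 (mulmv L z.1) + calG z.1.

Definition boltzmann_weight (z : X * X) : R :=
  expR (- (beta / 2) * ds * hamiltonian z).

Definition nu_extended (Z : R) (z : X * X) : R := Z^-1 * boltzmann_weight z.

Definition phi_minus (dtau : R) : 'M[R]_(d * n.-1) :=
  1%:M - (dtau ^+ 2 / 4) *: L.

Definition phi_plus (dtau : R) : 'M[R]_(d * n.-1) :=
  1%:M + (dtau ^+ 2 / 4) *: L.

Definition phi (dtau : R) (z : X * X) : X * X :=
  let u0 := z.1 in let p0 := z.2 in
  let u1 := mulmv (invmx (phi_minus dtau))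
    (mulmv (phi_plus dtau) u0 + dtau *: p0
     - (dtau ^+ 2 / 2) *: grad calG u0) in
  let p1 := mulmv (invmx (phi_minus dtau))
    (mulmv (phi_plus dtau) (p0 - (dtau / 2) *: grad calG u0)
     + dtau *: mulmv L u0)
    - (dtau / 2) *: grad calG u1 in
  (u1, p1).

End transition_path.

Arguments mala_step {R d} n beta S xm xp V dt theta {dT T} P u0 u1.
Arguments boltzmann_weight {R d} n beta S xm xp V z.
Arguments nu_extended {R d} n beta S xm xp V Z z.
Arguments phi_minus {R} d n S dtau.
Arguments phi {R d} n beta S xm xp V dtau z.
Arguments hmc_step {R N} nu phi {dT T} P u0 u1.

(* Main.v *)
Require Import Defs.
From HB Require Import structures.
From mathcomp Require Import all_boot all_order all_algebra.
From mathcomp Require Import all_classical all_reals all_analysis.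
From mathcomp Require Import measurable_realfun.
From mathcomp Require Import ring lra zify.
Set Implicit Arguments.
Unset Strict Implicit.
Unset Printing Implicit Defensive.
Import Order.TTheory GRing.Theory Num.Theory.
Import numFieldNormedType.Exports.
Local Open Scope classical_set_scope.
Local Open Scope ring_scope.

(** Write tau for the square root of 2 dt and s for the square root of
2 / (beta ds).  Two mechanisms make the two chains agree.

The map phi is a Strang splitting: half a kick p -> p - (tau / 2) grad calG u,
then the Crank-Nicolson (Cayley) step of the linear flow u' = p, p' = L u, then
half a kick again ([phiE]).  Each factor T satisfies T rho T = rho, where rho
flips the momentum, and this relation passes to palindromic products
([reversible_sandwich]).  A kick is a shear, so its Jacobian is unipotent
([det_jacobian_shear]); the Cayley step is linear, and M rho M = rho forces
(det M)^2 = 1 ([linear_reversible_volume_preserving]).  The matrix to be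
inverted is strictly diagonally dominant ([phi_minus_unit]).

For the equality in law, theta = 1/2 turns A_theta and B_theta into
I -+ (tau^2 / 4) L, and F = - grad calG ([grad_calG]); since tau s is the
coefficient of the MALA noise ([dtau_noise_scale]), the MALA proposal driven by
xi is exactly the position of phi (u0, s xi) ([phi_position]).  The quantity
under the Gaussian q (u0, u1) is then tau p0.  By reversibility u0 is the
position of phi (u1, - p1), so the quantity under q (u1, u0) is - tau p1.  Hence
q (u1, u0) pi (u1) and q (u0, u1) pi (u0) are the Boltzmann weights of (u1, p1)
and (u0, p0), and the two acceptance probabilities coincide
([mala_alpha_phi]).  Both chains thus apply one measurable function of a
momentum and an independent uniform variable.  It remains to see that s xi has
the law proportional to nu (u0, p) dp ([gaussian_momentum_law]): on boxes the
integral factorizes by Tonelli, the proportionality constant is fixed by the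
total mass, and a finite measure on R^n is determined by its values on
boxes ([finite_measure_rV_unique]). *)

(** * Invertibility by diagonal dominance, and time reversal of splittings *)

Section diagonal_dominance.
Context {R : realFieldType} {n : nat}.

(** At an entry of largest absolute value of a kernel vector, the diagonal term
cannot be compensated by the others (Levy-Desplanques). *)
Lemma diag_dominant_unitmx (A : 'M[R]_n) :
  (forall i, \sum_(j | j != i) `|A i j| < `|A i i|) -> A \in unitmx.
Proof.
move=> dom; rewrite -unitmx_tr -row_free_unit -kermx_eq0.
apply/eqP/row_matrixP => k; rewrite row0.
set v := row k _; have vA : v *m A^T = 0.
  by apply/sub_kermxP; exact: row_sub.
apply/eqP; apply: contraT => /rV0Pn[l vl].
have [i _ imax] :=
  Order.TotalTheory.arg_maxP (fun j => `|v 0 j|) (erefl : xpredT l).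
have vi : 0 < `|v 0 i| by apply: lt_le_trans (imax l isT); rewrite normr_gt0.
have : (v *m A^T) 0 i = 0 by rewrite vA mxE.
rewrite mxE (bigD1 i)//= => /eqP; rewrite addr_eq0 => /eqP vAi.
have := dom i; rewrite -(ltr_pM2r vi) -normrM ltNge => /negP; case.
rewrite mulrC; move: vAi; rewrite [A^T i i]mxE => ->; rewrite normrN mulr_suml.
apply: (le_trans (ler_norm_sum _ _ _)); apply: ler_sum => j ji.
by rewrite [A^T j i]mxE normrM mulrC ler_wpM2l//; exact: imax.
Qed.

End diagonal_dominance.

Section mulmv_theory.
Context {R : realType} {N : nat}.
Implicit Types (M : 'M[R]_N) (u v : 'rV[R]_N).

Lemma mulmvD M u v : mulmv M (u + v) = mulmv M u + mulmv M v.
Proof. exact: mulmxDl. Qed.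

Lemma mulmvN M u : mulmv M (- u) = - mulmv M u.
Proof. exact: mulNmx. Qed.

Lemma mulmvB M u v : mulmv M (u - v) = mulmv M u - mulmv M v.
Proof. by rewrite mulmvD mulmvN. Qed.

Lemma mulmvZ M a u : mulmv M (a *: u) = a *: mulmv M u.
Proof. by rewrite /mulmv scalemxAl. Qed.

Lemma mulmvZl M a u : mulmv (a *: M) u = a *: mulmv M u.
Proof. by rewrite /mulmv linearZ/= scalemxAr. Qed.

Lemma mulmvA M M' u : mulmv M (mulmv M' u) = mulmv (M *m M') u.
Proof. by rewrite /mulmv trmx_mul mulmxA. Qed.

Lemma mulmv_addZ M a u : mulmv (1%:M + a *: M) u = u + a *: mulmv M u.
Proof. by rewrite /mulmv linearD linearZ/= trmx1 mulmxDr mulmx1 scalemxAr. Qed.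

Lemma mulmv_subZ M a u : mulmv (1%:M - a *: M) u = u - a *: mulmv M u.
Proof. by rewrite -scaleNr mulmv_addZ scaleNr. Qed.

Lemma mulmvK M : M \in unitmx -> cancel (mulmv M) (mulmv (invmx M)).
Proof. by move=> uM u; rewrite mulmvA mulVmx// /mulmv trmx1 mulmx1. Qed.

Lemma mulmvVK M : M \in unitmx -> cancel (mulmv (invmx M)) (mulmv M).
Proof. by move=> uM u; rewrite mulmvA mulmxV// /mulmv trmx1 mulmx1. Qed.

Lemma dotvZ m (a : R) (u : 'rV[R]_m) : dotv (a *: u) (a *: u) = a ^+ 2 * dotv u u.
Proof.
by rewrite /dotv mulr_sumr; apply: eq_bigr => i _; rewrite !mxE expr2 mulrACA.
Qed.

Lemma dotvN m (u : 'rV[R]_m) : dotv (- u) (- u) = dotv u u.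
Proof. by rewrite -scaleN1r dotvZ sqrrN expr1n mul1r. Qed.

End mulmv_theory.

Section splitting.
Context {R : realType} {N : nat}.
Local Notation X := 'rV[R]_N.
Variables (M : 'M[R]_N) (t : R).

(** The momentum update over half a time step [t] of the flow p' = - g u. *)
Definition kick (g : X -> X) (z : X * X) : X * X := (z.1, z.2 - t / 2 *: g z.1).

Definition cayley_minus : 'M[R]_N := 1%:M - (t ^+ 2 / 4) *: M.
Definition cayley_plus : 'M[R]_N := 1%:M + (t ^+ 2 / 4) *: M.

(** The implicit midpoint step of size [t] for the linear system u' = p,
p' = M u, with the implicit equations solved. *)
Definition cayley (z : X * X) : X * X :=
  (mulmv (invmx cayley_minus) (mulmv cayley_plus z.1 + t *: z.2),
   mulmv (invmx cayley_minus) (mulmv cayley_plus z.2 + t *: mulmv M z.1)).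

Lemma kick_reversible g : reversible (kick g).
Proof. by move=> [u p]; rewrite /kick /momentum_flip/= opprB addrAC subrr sub0r. Qed.

Hypothesis unit_minus : cayley_minus \in unitmx.

(** Everything commutes with [M], so after clearing the inverses the claim is
the scalar identity (1 - t^2 m / 4)^2 = (1 + t^2 m / 4)^2 - t^2 m. *)
Lemma cayley_reversible : reversible cayley.
Proof.
move=> [u p]; rewrite /momentum_flip/=.
have AB z : mulmv cayley_minus (mulmv cayley_plus z) =
            mulmv cayley_plus (mulmv cayley_minus z).
  rewrite !(mulmv_addZ, mulmv_subZ, mulmvD, mulmvN, mulmvZ).
  move: (mulmv M (mulmv M z)) (mulmv M z) => a b.
  by apply/rowP => i; rewrite !mxE; ring.
have AL z : mulmv cayley_minus (mulmv M z) = mulmv M (mulmv cayley_minus z).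
  by rewrite !mulmv_subZ mulmvB mulmvZ.
(* One factor of [cayley_minus] is cleared for each of the two Cayley steps. *)
congr pair; apply: (can_inj (mulmvK unit_minus)); rewrite /= mulmvVK//;
    apply: (can_inj (mulmvK unit_minus));
    rewrite ?scalerN (mulmvB, mulmvD) ?mulmvN !mulmvZ AB ?AL !mulmvVK//;
    rewrite !(mulmv_addZ, mulmv_subZ, mulmvD, mulmvN, mulmvZ);
    [move: (mulmv M (mulmv M u)) (mulmv M u) (mulmv M p)|
     move: (mulmv M (mulmv M p)) (mulmv M u) (mulmv M p)] => a b c;
    by apply/rowP => i; rewrite !mxE; field.
Qed.

End splitting.

(** In f g f rho f g f the inner f rho f collapses to rho, then g rho g, then
the outer f rho f. *)
Lemma reversible_sandwich (R : realType) (N : nat)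
    (f g : 'rV[R]_N * 'rV[R]_N -> 'rV[R]_N * 'rV[R]_N) :
  reversible f -> reversible g -> reversible (f \o g \o f).
Proof.
move=> rf rg z /=; have /= -> := rf (g (f z)).
by have /= -> := rg (f z); exact: rf.
Qed.

(** * The splitting of the Hamiltonian map *)

Lemma sum_nat_eq_le1 N (k : nat) : (\sum_(j < N) (nat_of_ord j == k) <= 1)%N.
Proof.
have [kN|Nk] := ltnP k N.
  rewrite (bigD1 (Ordinal kN))//= eqxx big1// => j; rewrite -val_eqE/= => /negbTE.
  by move=> ->.
by rewrite big1// => j _; rewrite ltn_eqF// (leq_trans _ Nk).
Qed.

Section transition_path_splitting.
Context {R : realType} {d : nat}.
Variables (n : nat) (beta S : R) (xm xp : 'rV[R]_d) (V : 'rV[R]_d -> R) (dtau : R).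
Hypothesis d_gt0 : (0 < d)%N.

(** A row has at most two nonzero entries off the diagonal, in the columns i + d
and i - d; where i < d the truncated difference 0 only enlarges the bound. *)
Lemma L_offdiag_le (i : 'I_(d * n.-1)) :
  \sum_(j | j != i) `|L n S i j| <= 2 * (ds n S ^+ 2)^-1.
Proof.
have w0 : 0 <= (ds n S ^+ 2)^-1 by rewrite invr_ge0 sqr_ge0.
apply: (@le_trans _ _ (\sum_(j < d * n.-1)
    (ds n S ^+ 2)^-1 * ((nat_of_ord j == i + d)%N + (nat_of_ord j == i - d)%N)%:R)).
  rewrite big_mkcond/=; apply: ler_sum => j _; case: ifPn => [ji|_]; last first.
    by rewrite mulr_ge0.
  rewrite mxE eq_sym (negbTE ji); case: ifPn => [/eqP ijd|_]; last first.
    by rewrite normr0 mulr_ge0.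
  rewrite div1r ger0_norm// ler_peMr// ler1n.
  have [->|->] : nat_of_ord j = (i + d)%N \/ nat_of_ord j = (i - d)%N by lia.
  - by rewrite eqxx.
  - by rewrite eqxx addn1.
rewrite -mulr_sumr -natr_sum big_split/= mulrC ler_wpM2r// ler_nat.
by apply: (leq_add (sum_nat_eq_le1 _ _) (sum_nat_eq_le1 _ _)).
Qed.

(** With c = dtau^2 / 4 and w = 1 / ds^2, the diagonal entry 1 + 2 c w exceeds
the bound 2 c w on the rest of the row. *)
Lemma phi_minus_unit : phi_minus d n S dtau \in unitmx.
Proof.
apply: diag_dominant_unitmx => i.
have c0 : 0 <= dtau ^+ 2 / 4 by rewrite divr_ge0// sqr_ge0.
have w0 : 0 <= (ds n S ^+ 2)^-1 by rewrite invr_ge0 sqr_ge0.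
rewrite (eq_bigr (fun j => (dtau ^+ 2 / 4) * `|L n S i j|)); last first.
  move=> j ji; rewrite !mxE eq_sym (negbTE ji) sub0r normrN normrM (ger0_norm c0).
  by [].
rewrite -mulr_sumr; apply: (le_lt_trans (ler_wpM2l c0 (L_offdiag_le i))).
have key (c w : R) : 0 <= c -> 0 <= w -> c * (2 * w) < `|1 - c * (- 2 * w)|.
  move=> c0' w0'; have := mulr_ge0 c0' w0'; rewrite mulrCA mulNr mulrN opprK => cw.
  by rewrite ger0_norm; lra.
by rewrite !mxE eqxx mulr1n; exact: key.
Qed.

Let gradG := grad (calG beta S xm xp V : 'rV_(d * n.-1) -> R).

(** The first half kick is what produces the terms in grad calG u of both
components; the second one only updates the momentum, at the new position. *)
Lemma phiE : phi n beta S xm xp V dtau =1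
  kick dtau gradG \o cayley (L n S) dtau \o kick dtau gradG.
Proof.
move=> [u p]; rewrite /phi /kick /cayley /=.
have -> : mulmv (phi_plus n S dtau) u + dtau *: p - dtau ^+ 2 / 2 *: gradG u =
    mulmv (cayley_plus (L n S) dtau) u + dtau *: (p - dtau / 2 *: gradG u).
  by rewrite scalerBr scalerA mulrA -expr2 addrA.
by [].
Qed.

Lemma phi_reversible : reversible (phi n beta S xm xp V dtau).
Proof.
rewrite (funext phiE); apply: reversible_sandwich; first exact: kick_reversible.
exact: (cayley_reversible phi_minus_unit).
Qed.

End transition_path_splitting.

(** * Jacobians *)

Section jacobian_rules.
Context {R : numFieldType}.

Lemma eq_mulmx_row m n (A B : 'M[R]_(m, n)) :
  (forall v : 'rV[R]_m, v *m A = v *m B) -> A = B.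
Proof. by move=> AB; apply/row_matrixP => i; rewrite !rowE AB. Qed.

Lemma mul_jacobian m n (f : 'rV[R]_m -> 'rV[R]_n) x v :
  v *m 'J f x = 'd f x v.
Proof. by rewrite /jacobian mul_rV_lin1. Qed.

Lemma differentiable_rV (W : normedModType R) n (f : W -> 'rV[R]_n) x :
  (forall i, differentiable (fun y => f y 0 i) x) -> differentiable f x.
Proof.
move=> df; rewrite (_ : f = \sum_(i < n) (fun y => f y 0 i *: delta_mx 0 i)).
  by apply: differentiable_sum => i; exact: differentiableZl.
by apply/funext => y; rewrite fct_sumE [LHS]row_sum_delta.
Qed.

Lemma differentiable_coordE (W : normedModType R) n (f : W -> 'rV[R]_n) x i :
  differentiable f x -> differentiable (fun y => f y 0 i) x.
Proof.
move=> df; apply: (@differentiable_comp _ _ _ _ f (fun v : 'rV[R]_n => v 0 i)) => //.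
exact: differentiable_coord.
Qed.

Lemma differentiable_mulmxr m n (M : 'M[R]_(m, n)) (x : 'rV[R]_m) :
  differentiable (mulmxr M) x.
Proof.
apply: differentiable_rV => i.
rewrite (_ : (fun _ => _) = \sum_(j < m) (fun v : 'rV[R]_m => v 0 j *: M j i)).
  apply: differentiable_sum => j.
  apply: (@differentiableZl _ _ _ (fun v : 'rV[R]_m => v 0 j)).
  exact: differentiable_coord.
by apply/funext => v; rewrite fct_sumE mxE.
Qed.

Lemma diff_mulmxr m n (M : 'M[R]_(m, n)) (x : 'rV[R]_m) :
  'd (mulmxr M) x = mulmxr M :> ('rV[R]_m -> 'rV[R]_n).
Proof.
by apply: diff_lin => y; exact/differentiable_continuous/differentiable_mulmxr.
Qed.

Lemma jacobian_mulmxr m n (M : 'M[R]_(m, n)) (x : 'rV[R]_m) : 'J (mulmxr M) x = M.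
Proof. by apply: eq_mulmx_row => v; rewrite mul_jacobian diff_mulmxr. Qed.

Lemma jacobian_comp m n p (f : 'rV[R]_m -> 'rV[R]_n) (g : 'rV[R]_n -> 'rV[R]_p) x :
  differentiable f x -> differentiable g (f x) ->
  'J (g \o f) x = 'J f x *m 'J g (f x).
Proof.
move=> df dg; apply: eq_mulmx_row => v.
by rewrite mulmxA !mul_jacobian diff_comp.
Qed.

Lemma diff_idB (W : normedModType R) (f : W -> W) (x v : W) :
  differentiable f x -> 'd (fun y => y - f y) x v = v - 'd f x v.
Proof.
move=> df; have did : differentiable (@id W) x by exact: ex_diff.
rewrite -[fun y => _]/(id - f) diffB// /Algebra.sub_fun.
have cid : continuous (idfun : {linear W -> W}) by move=> y; exact: cvg_id.
congr (_ - _); have h := diff_lin x cid.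
exact: (f_equal (fun k : W -> W => k v) h).
Qed.

Lemma differentiable_idB (W : normedModType R) (f : W -> W) (x : W) :
  differentiable f x -> differentiable (fun y => y - f y) x.
Proof.
by move=> df; apply: (@differentiableB _ _ _ id f) => //; exact: ex_diff.
Qed.

Lemma jacobian_idB m (f : 'rV[R]_m -> 'rV[R]_m) x :
  differentiable f x -> 'J (fun y => y - f y) x = 1%:M - 'J f x.
Proof.
move=> df; apply: eq_mulmx_row => v.
rewrite [RHS]mulmxBr [X in _ = X - _]mulmx1 [LHS]mul_jacobian.
rewrite [X in _ = _ - X]mul_jacobian; exact: diff_idB.
Qed.

Lemma norm_det_mulmx m (A B : 'M[R]_m) :
  `|\det A| = 1 -> `|\det B| = 1 -> `|\det (A *m B)| = 1.
Proof. by move=> A1 B1; rewrite det_mulmx normrM A1 B1 mulr1. Qed.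

Lemma norm_det_jacobian_comp m (f g : 'rV[R]_m -> 'rV[R]_m) x :
  differentiable f x -> differentiable g (f x) ->
  `|\det ('J f x)| = 1 -> `|\det ('J g (f x))| = 1 ->
  `|\det ('J (g \o f) x)| = 1.
Proof.
move=> df dg; rewrite (jacobian_comp df dg); exact: norm_det_mulmx.
Qed.

Lemma differentiable_shear m p (P : 'M[R]_(p, m)) (Q : 'M[R]_(m, p))
    (g : 'rV[R]_p -> 'rV[R]_p) x :
  differentiable g (x *m Q) ->
  differentiable (fun y => y - (mulmxr P \o (g \o mulmxr Q)) y) x.
Proof.
move=> dg; apply: differentiable_idB; apply: differentiable_comp.
  by apply: differentiable_comp => //; exact: differentiable_mulmxr.
exact: differentiable_mulmxr.
Qed.

(** The map (u, p) |-> (u, p - c g u): with [Q] the projection to the position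
and [P] the scaled embedding of the momentum, its Jacobian is the identity minus
a block matrix whose only nonzero block lies above the diagonal. *)
Lemma det_jacobian_shear p (c : R) (g : 'rV[R]_p -> 'rV[R]_p) x
    (Q := col_mx 1%:M 0 : 'M[R]_(p + p, p))
    (P := row_mx 0 c%:M : 'M[R]_(p, p + p)) :
  differentiable g (x *m Q) ->
  \det ('J (fun y => y - (mulmxr P \o (g \o mulmxr Q)) y) x) = 1.
Proof.
move=> dg; have dQ := differentiable_mulmxr Q x.
have dgQ : differentiable (g \o mulmxr Q) x by apply: differentiable_comp.
have dP := differentiable_mulmxr P ((g \o mulmxr Q) x).
rewrite (jacobian_idB (differentiable_comp dgQ dP)) (jacobian_comp dgQ dP).
rewrite (jacobian_comp dQ dg) !jacobian_mulmxr.
rewrite mul_col_mx mul1mx mul0mx mul_col_mx !mul_mx_row !mulmx0 mul0mx.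
rewrite -[X in \det (X - _)](@submxK _ p p p p) scalar_mx_block.
rewrite opp_block_mx add_block_mx.
by rewrite !(block_mxKul, block_mxKur, block_mxKdl, block_mxKdr) !oppr0 !addr0
  det_ublock !det1 mulr1.
Qed.

End jacobian_rules.

(** * Volume preservation of kicks and of Cayley steps *)

Section volume.
Context {R : realType} {N : nat}.
Local Notation X := 'rV[R]_N.
Implicit Types (f : X * X -> X * X) (g : X -> X).

Lemma volume_preserving_comp f f' :
  volume_preserving f -> volume_preserving f' -> volume_preserving (f' \o f).
Proof.
move=> vf vf' z.
have E : flat_map (f' \o f) = flat_map f' \o flat_map f.
  apply/funext => y; rewrite /flat_map /= row_mxKl row_mxKr.
  by rewrite -surjective_pairing.
have [df Jf] := vf z; have [df' Jf'] := vf' (flat_map f z).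
rewrite E; split; first exact: differentiable_comp.
exact: norm_det_jacobian_comp.
Qed.

Lemma kick_volume_preserving (t : R) g :
  (forall x, differentiable g x) -> volume_preserving (kick t g).
Proof.
move=> dg z.
pose Q : 'M[R]_(N + N, N) := col_mx 1%:M 0.
pose P : 'M[R]_(N, N + N) := row_mx 0 (t / 2)%:M.
have E : flat_map (kick t g) = fun y => y - (mulmxr P \o (g \o mulmxr Q)) y.
  apply/funext => y; rewrite /flat_map /kick/= -[y in RHS]hsubmxK.
  rewrite [in X in _ = X](_ : row_mx (lsubmx y) (rsubmx y) *m Q = lsubmx y).
    rewrite mul_mx_row mulmx0 mul_mx_scalar.
    by rewrite opp_row_mx add_row_mx subr0.
  by rewrite mul_row_col mulmx1 mulmx0 addr0.
rewrite E; split; first exact: differentiable_shear.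
by have /(congr1 Num.norm) := det_jacobian_shear (t / 2) (dg (z *m Q)); rewrite normr1.
Qed.

(** Taking determinants in M rho M = rho, where det rho is nonzero, leaves
(det M)^2 = 1. *)
Lemma linear_reversible_volume_preserving f (M : 'M[R]_(N + N)) :
  flat_map f = mulmxr M -> reversible f -> volume_preserving f.
Proof.
move=> fM rf z; rewrite fM jacobian_mulmxr; split.
  exact: differentiable_mulmxr.
pose r : 'M[R]_(N + N) := block_mx 1%:M 0 0 (- 1%:M).
have rE (v : 'rV[R]_(N + N)) : v *m r = row_mx (lsubmx v) (- rsubmx v).
  by rewrite -[in LHS](hsubmxK v) mul_row_block !mulmx0 mulmxN !mulmx1 addr0 add0r.
have MrM : M *m r *m M = r.
  apply: eq_mulmx_row => v; rewrite !mulmxA -[v *m M]/(mulmxr M v) -fM.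
  rewrite -[LHS]/(mulmxr M _) -fM !rE /flat_map/= !row_mxKl !row_mxKr.
  by have := rf (lsubmx v, rsubmx v); rewrite /= => ->.
have : \det M ^+ 2 * \det r = \det r.
  by rewrite -[in RHS]MrM !det_mulmx expr2 mulrAC.
have r0 : \det r != 0.
  by rewrite det_ublock det1 mul1r -scaleN1r scalemx1 det_scalar expf_neq0//
    oppr_eq0 oner_eq0.
rewrite -[RHS in _ = RHS]mul1r => /(mulIf r0)/eqP.
rewrite sqrf_eq1 => /orP[] /eqP ->; by rewrite ?normrN normr1.
Qed.

Lemma cayley_volume_preserving (L : 'M[R]_N) (t : R) :
  cayley_minus L t \in unitmx -> volume_preserving (cayley L t).
Proof.
move=> uA; set Am := invmx (cayley_minus L t); set B := cayley_plus L t.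
apply: (@linear_reversible_volume_preserving _
  (block_mx (Am *m B)^T (t *: (Am *m L))^T (t *: Am)^T (Am *m B)^T)).
  apply/funext => z; rewrite /= -[z in RHS]hsubmxK mul_row_block /flat_map/=.
  rewrite !mulmvD !mulmvZ -/Am -/B !mulmvA -!mulmvZl.
  by congr row_mx; rewrite addrC.
exact: cayley_reversible.
Qed.

End volume.

(** * Regularity and gradient of the path potential *)

Section smoothness.
Context {R : realType} {n : nat}.
Implicit Types (f g : 'rV[R]_n -> R) (k : nat).

Lemma cd_differentiable k f :
  continuously_differentiable k.+1 f -> forall x, differentiable f x.
Proof. by case. Qed.

Lemma cd_partial k f i :
  continuously_differentiable k.+1 f -> continuously_differentiable k (partial i f).
Proof. by move=> [_]; exact. Qed.

Lemma cd_pred k f : continuously_differentiable k.+1 f -> continuously_differentiable k f.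
Proof.
elim: k f => [|k IH] f [df pf]; first by move=> x; exact: differentiable_continuous.
by split=> // i; exact: IH.
Qed.

Lemma cdD k f g : continuously_differentiable k f -> continuously_differentiable k g ->
  continuously_differentiable k (f + g).
Proof.
elim: k f g => [|k IH] f g; first by move=> cf cg x; exact: (continuousD (cf x) (cg x)).
move=> [df pf] [dg pg]; split=> [x|i]; first exact: differentiableD.
rewrite (_ : partial i (f + g) = partial i f + partial i g).
  exact: (IH _ _ (pf i) (pg i)).
by apply/funext => x; rewrite /partial deriveD//; exact: diff_derivable.
Qed.

Lemma cdM k f g : continuously_differentiable k f -> continuously_differentiable k g ->
  continuously_differentiable k (f * g).
Proof.
elim: k f g => [|k IH] f g; first by move=> cf cg x; exact: (continuousM (cf x) (cg x)).
move=> cf cg; have [df pf] := cf; have [dg pg] := cg.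
split=> [x|i]; first exact: differentiableM.
rewrite (_ : partial i (f * g) = f * partial i g + g * partial i f).
  exact: (cdD (IH _ _ (cd_pred cf) (pg i)) (IH _ _ (cd_pred cg) (pf i))).
by apply/funext => x; rewrite /partial deriveM//; exact: diff_derivable.
Qed.

Lemma cd_cst k (c : R) : continuously_differentiable k (fun _ : 'rV[R]_n => c).
Proof.
elim: k c => [|k IH] c; first exact: cst_continuous.
split=> [x|i]; first exact: differentiable_cst.
rewrite (_ : partial _ _ = fun=> 0); first exact: IH.
by apply/funext => x; rewrite /partial derive_cst.
Qed.

Lemma cd_sum k m (f : 'I_m -> 'rV[R]_n -> R) :
  (forall i, continuously_differentiable k (f i)) ->
  continuously_differentiable k (\sum_(i < m) f i).
Proof.
move=> cf; elim/big_ind : _ => [|g h|i _]; [exact: cd_cst|exact: cdD|exact: cf].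
Qed.

Lemma differentiable_grad f x :
  continuously_differentiable 2 f -> differentiable (grad f) x.
Proof.
move=> cf; apply: differentiable_rV => i.
rewrite (_ : (fun _ => _) = partial i f).
  exact: (cd_differentiable (cd_partial i cf)).
by apply/funext => y; rewrite mxE.
Qed.

(** [G] involves two derivatives of [V], which leaves two of the four. *)
Lemma cd_G (beta : R) (V : 'rV[R]_n -> R) :
  continuously_differentiable 4 V -> continuously_differentiable 2 (G beta V).
Proof.
move=> cV; rewrite (_ : G beta V =
   (fun=> 2^-1) * (\sum_(i < n) partial i V * partial i V)
   + (fun=> - beta^-1) * (\sum_(i < n) partial i (partial i V))).
  have cp i := cd_partial i cV.
  apply: cdD; apply: cdM; try exact: cd_cst; apply: cd_sum => i.
    by apply: cdM; exact: cd_pred.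
  exact: cd_partial.
apply/funext => x; rewrite /G /dotv /laplacian !fctE mulNr; congr (_ * _ - _ * _).
  by rewrite fct_sumE; apply: eq_bigr => i _; rewrite !mxE.
by rewrite fct_sumE.
Qed.

End smoothness.

Section diff_rules.
Context {K : numFieldType} {W W' : normedModType K}.

Lemma differentiable_addcst (f : W -> W') (c : W') x :
  differentiable f x -> differentiable (fun y => f y + c) x.
Proof. by move=> df; apply: (@differentiableD _ _ _ f (cst c)). Qed.

Lemma diff_addcst (f : W -> W') (c : W') x :
  differentiable f x -> 'd (fun y => f y + c) x = 'd f x :> (W -> W').
Proof.
move=> df; rewrite -[fun y => _]/(f + cst c) (diffD df (differentiable_cst _ _)).
by apply/funext => v; rewrite /Algebra.add_fun diff_cst; exact: addr0.
Qed.

Lemma diff_sum m (f : 'I_m -> W -> W') x v :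
  (forall i, differentiable (f i) x) ->
  'd (\sum_(i < m) f i) x v = \sum_(i < m) 'd (f i) x v.
Proof.
elim: m f => [|m IH] f df.
  by rewrite !big_ord0 -[0]/(cst 0) diff_cst.
rewrite !big_ord_recr/= -(IH _ (fun i => df _)).
have ds : differentiable (\sum_(i < m) f (widen_ord (leqnSn m) i)) x.
  by apply: differentiable_sum => i; exact: df.
by rewrite (diffD ds (df ord_max)).
Qed.

End diff_rules.

Section path_gradient.
Context {R : realType} {d n : nat}.
Variables (beta S : R) (xm xp : 'rV[R]_d) (V : 'rV[R]_d -> R).
Hypothesis smoothV : continuously_differentiable 4 V.
Local Notation X := 'rV[R]_(d * n.-1).

Let G' := G beta V.
Let dG x : differentiable G' x := cd_differentiable (cd_G beta smoothV) x.

(** The matrix of [block], so that the differential of a path point is a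
right multiplication. *)
Definition block_mat (i : 'I_n.-1) : 'M[R]_(d * n.-1, d) :=
  \matrix_(l, k) (l == block_index i k)%:R.

Lemma block_mulmx (u : X) i : block u i = u *m block_mat i.
Proof.
apply/rowP => k; rewrite !mxE (bigD1 (block_index i k))//= mxE eqxx mulr1.
by rewrite big1 ?addr0// => l /negbTE lk; rewrite mxE lk mulr0.
Qed.

Let pp i (u : X) := path_point S xm xp u i.

Let ppE i : pp i = fun u => mulmxr (block_mat i) u + psi S xm xp (i.+1%:R * ds n S).
Proof. by apply/funext => v; rewrite /pp /path_point block_mulmx. Qed.

Lemma differentiable_path_point i (u : X) : differentiable (pp i) u.
Proof. by rewrite ppE; apply/differentiable_addcst/differentiable_mulmxr. Qed.

Lemma diff_path_point i (u v : X) : 'd (pp i) u v = v *m block_mat i.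
Proof.
rewrite ppE (diff_addcst _ (differentiable_mulmxr _ _)).
by rewrite diff_mulmxr.
Qed.

Lemma differentiable_calG (u : X) : differentiable (calG beta S xm xp V) u.
Proof.
rewrite (_ : calG beta S xm xp V = \sum_(i < n.-1) (G' \o pp i)).
  apply: differentiable_sum => i.
  exact: differentiable_comp (differentiable_path_point _ _) (dG _).
by apply/funext => v; rewrite fct_sumE.
Qed.

Lemma diff_calG (u v : X) :
  'd (calG beta S xm xp V) u v =
  \sum_(i < n.-1) 'd G' (pp i u) (v *m block_mat i).
Proof.
rewrite (_ : calG beta S xm xp V = \sum_(i < n.-1) (G' \o pp i)); last first.
  by apply/funext => w; rewrite fct_sumE.
rewrite diff_sum; last first.
  by move=> i; exact: differentiable_comp (differentiable_path_point _ _) (dG _).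
apply: eq_bigr => i _.
rewrite (diff_comp (differentiable_path_point i u) (dG _)) /=.
by rewrite diff_path_point.
Qed.

(** The coordinate [j] of the path moves only the point of block [j %/ d], so a
single summand of [calG] contributes to the partial derivative. *)
Lemma grad_calG (u : X) : grad (calG beta S xm xp V) u = - F beta S xm xp V u.
Proof.
apply/rowP => j; rewrite !mxE opprK /partial deriveE; last exact: differentiable_calG.
set i := Ordinal (block_of_index_subproof j); set k := Ordinal (pos_of_index_subproof j).
have jE : j = block_index i k by apply/val_inj; rewrite /= -divn_eq.
have rowE l : delta_mx 0 j *m block_mat l =
    if l == i then delta_mx 0 k else 0 :> 'rV[R]_d.
  rewrite -rowE; apply/rowP => m; rewrite !mxE jE -val_eqE/=.
  case: ifPn => [/eqP ->|li]; first by rewrite mxE eqxx/= eqn_add2l eq_sym.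
  rewrite mxE; case: eqP => // e; case/eqP: li; apply/val_inj => /=.
  have d0 : (0 < d)%N := leq_ltn_trans (leq0n _) (ltn_ord m).
  have := congr1 (divn^~ d) e; rewrite /= !divnMDl// (divn_small (ltn_ord m)).
  by rewrite (divn_small (ltn_pmod j d0)) !addn0.
rewrite diff_calG (bigD1 i)//= rowE eqxx big1 ?addr0.
  by rewrite deriveE//; exact: dG.
by move=> l /negbTE li; rewrite rowE li linear0.
Qed.

Lemma differentiable_grad_calG (u : X) :
  differentiable (grad (calG beta S xm xp V)) u.
Proof.
rewrite (funext grad_calG); apply: differentiable_rV => j.
rewrite (_ : (fun _ => _) = (fun y => grad G' y 0 (Ordinal (pos_of_index_subproof j)))
    \o pp (Ordinal (block_of_index_subproof j))).
  apply: differentiable_comp (differentiable_path_point _ _) _.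
  by apply: differentiable_coordE; exact/differentiable_grad/cd_G.
by apply/funext => v; rewrite /= !mxE opprK.
Qed.

End path_gradient.

(** * The Borel sigma-algebra of R^n *)

Section borel_rV.
Context {R : realType} {n : nat}.
Local Notation X := 'rV[R]_n.

Definition box (B : 'I_n -> set R) : set X := [set v | forall i, B i (v 0 i)].

Lemma measurable_box B : (forall i, measurable (B i)) -> measurable (box B).
Proof.
move=> mB; rewrite (_ : box B =
    \bigcap_(i in [set: 'I_n]) ((fun v : X => v 0 i) @^-1` B i)); last first.
  by apply/seteqP; split => [v h i _|v h i]; [exact: h|exact: h].
apply: fin_bigcap_measurable => // i _.
by rewrite -[X in measurable X]setTI; exact: measurable_coord.
Qed.

Definition rat_cube (c : {ffun 'I_n -> rat} * nat) : set X :=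
  box (fun i => ball (ratr (c.1 i) : R) c.2.+1%:R^-1).

(** Balls of the sup norm are cubes, and the countably many rational cubes form
a base: the sigma-algebra of the coordinates is the Borel one. *)
Lemma open_measurable_rV (U : set X) : open U -> measurable U.
Proof.
move=> oU.
rewrite (_ : U = \bigcup_(c in [set c | rat_cube c `<=` U]) rat_cube c).
  rewrite bigcup_mkcond; apply: countable_bigcupT_measurable.
    exact: countableP.
  by move=> c; case: ifP => // _; apply: measurable_box => i; exact: measurable_ball.
apply/seteqP; split=> [x Ux|x [c /= cU /cU //]].
have /nbhs_ballP[e /= e0 xeU] : nbhs x U by exact: open_nbhs_nbhs.
(* A rational cube of half-side less than e / 2 around a centre that close to x
has all its points within e of x. *)
have [k ke] : exists k, k.+1%:R^-1 < e / 2.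
  have [k _ /(_ k (leqnn _)) /=] :=
    near_infty_natSinv_lt (PosNum (divr_gt0 e0 (ltr0n _ 2))).
  by exists k.
have k0 : 0 < k.+1%:R^-1 :> R by rewrite invr_gt0.
have /choice[q qE] : forall i, exists q : rat, `|x 0 i - ratr q| < k.+1%:R^-1.
  move=> i; have : x 0 i - k.+1%:R^-1 < x 0 i + k.+1%:R^-1.
    by rewrite ltrBlDr -addrA ltrDl addr_gt0.
  move/rat_in_itvoo => [q]; rewrite in_itv/= => /andP[? ?]; exists q.
  by rewrite ltr_distl; apply/andP; split; rewrite -?ltrBlDr // ltrBlDr.
exists ([ffun i => q i], k) => [v|i] /=; last by rewrite ffunE /ball/= distrC.
move=> vc; apply: xeU; split=> // j i; rewrite ord1.
have := vc i; rewrite /= ffunE /ball/= => qv.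
rewrite (splitr e); apply: (ball_triangle (y := ratr (q i) : R)); rewrite /ball/=.
  exact: lt_trans (qE i) ke.
exact: lt_trans qv ke.
Qed.

Lemma continuous_measurable_rV (f : X -> R) :
  continuous f -> measurable_fun [set: X] f.
Proof.
move=> cf; apply: (measurability (@RGenOpens.G R)) => //.
  exact: RGenOpens.measurableE.
move=> _ [_ [a [b ->] <-]]; rewrite setTI; apply: open_measurable_rV.
by apply: open_comp => // + _; exact: cf.
Qed.

(** Boxes are stable under intersection and contain the generators of the
sigma-algebra of R^n. *)
Lemma finite_measure_rV_unique (m1 m2 : {measure set X -> \bar R}) :
  (m1 setT < +oo)%E ->
  (forall B, (forall i, measurable (B i)) -> m1 (box B) = m2 (box B)) ->
  forall A, measurable A -> m1 A = m2 A.
Proof.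
move=> m1oo m12.
pose Bx := [set A : set X | exists2 B, forall i, measurable (B i) & A = box B].
have boxT : Bx setT.
  by exists (fun=> setT) => //; apply/seteqP; split.
have mE : measurable = <<s Bx >> :> set (set X).
  apply/seteqP; split.
    apply: smallest_sub; first exact: smallest_sigma_algebra.
    rewrite -bigcup_seq; apply: bigcup_sub => i _ _ [B mB <-].
    apply: sub_sigma_algebra.
    exists (fun j => if j == i then B else setT) => [j|]; first by case: ifP.
    rewrite setTI; apply/seteqP; split=> [v Bv j|v /(_ i)]; last by rewrite eqxx.
    by case: eqP => // ->.
  apply: smallest_sub; first exact: sigma_algebra_measurable.
  by move=> _ [B mB ->]; exact: measurable_box.
apply: (measure_unique Bx (fun=> setT)) => //.
- move=> _ _ [B mB ->] [B' mB' ->]; exists (fun i => B i `&` B' i).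
    by move=> i; exact: measurableI.
  by apply/seteqP; split=> [v [? ?] i|v h]; split=> // i; have [] := h i.
- by rewrite bigcup_const.
- by move=> _ [B mB ->]; exact: m12.
Qed.

End borel_rV.

(** * Integration on R^n *)

Section product_integrals.
Context {R : realType}.
Local Open Scope ereal_scope.
Local Notation mu := (@lebesgue_measure R).

Lemma measurable_prod_coord n (f : 'I_n -> R -> R) :
  (forall i, measurable_fun setT (f i)) ->
  measurable_fun setT (fun v : 'rV[R]_n => (\prod_(i < n) f i (v 0%R i))%R).
Proof.
move=> mf; apply: measurable_prod => i _.
by apply: measurableT_comp (mf i) (measurable_coord i).
Qed.

(** Lebesgue measure on R^(n+1) is the image of a product measure, so each
induction step is one use of Tonelli. *)
Lemma integral_lebesgue_rV_prod n (f : 'I_n -> R -> R) :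
  (forall i, measurable_fun setT (f i)) -> (forall i x, (0 <= f i x)%R) ->
  \int[lebesgue_rV n]_v (\prod_(i < n) f i (v 0%R i))%:E =
  \prod_(i < n) \int[mu]_x (f i x)%:E.
Proof.
elim: n f => [|n IH] f mf f0.
  rewrite big_ord0 /= integral_dirac ?diracT ?big_ord0 ?mul1e//.
  by apply/measurable_EFinP; exact: measurable_prod_coord mf.
transitivity (\int[pushforward (mu \x lebesgue_rV n) (@rVcons R n)]_v
     (\prod_(i < n.+1) f i (v 0%R i))%:E).
  by apply: eq_measure_integral => //; exact: measurable_rVcons.
have mprod := @measurable_prod_coord n.+1 f mf.
rewrite ge0_integral_pushforward//; last 3 first.
  exact: measurable_rVcons.
  exact/measurable_EFinP.
  by move=> v _; rewrite lee_fin prodr_ge0.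
rewrite preimage_setT.
have mF : measurable_fun setT
    (fun z : R * 'rV[R]_n => (\prod_(i < n.+1) f i (rVcons z 0%R i))%:E).
  apply/measurable_EFinP.
  exact: (measurableT_comp mprod (@measurable_rVcons R n)).
rewrite fubini_tonelli1//; last by move=> z; rewrite lee_fin prodr_ge0.
rewrite /fubini_F big_ord_recl -IH//.
set I := \int[lebesgue_rV n]_v _.
have I0 : 0 <= I by apply: integral_ge0 => v _; rewrite lee_fin prodr_ge0.
rewrite -ge0_integralZr//; last 2 first.
  by apply/measurable_EFinP; exact: mf.
  by move=> x _; rewrite lee_fin.
apply: eq_integral => x _.
rewrite -ge0_integralZl//; last 3 first.
  apply/measurable_EFinP.
  exact: (@measurable_prod_coord n (fun i => f (lift ord0 i)) (fun i => mf _)).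
  by move=> v _; rewrite lee_fin prodr_ge0.
  by rewrite lee_fin.
apply: eq_integral => v _; rewrite /= big_ord_recl rVconsE0 EFinM; congr (_ * _%:E).
by apply: eq_bigr => i _; rewrite rVconsES.
Qed.

Lemma integral_lebesgue_rV_box n (f : R -> R) (B : 'I_n -> set R) :
  measurable_fun setT f -> (forall x, (0 <= f x)%R) ->
  (forall i, measurable (B i)) ->
  \int[lebesgue_rV n]_(v in box B) (\prod_(i < n) f (v 0%R i))%:E =
  \prod_(i < n) \int[mu]_(x in B i) (f x)%:E.
Proof.
move=> mf f0 mB; rewrite integral_mkcond.
under [RHS]eq_bigr do rewrite integral_mkcond.
(* The indicator of a box is the product of the indicators of its sides. *)
transitivity (\int[lebesgue_rV n]_v (\prod_(i < n) (f \_ (B i)) (v 0%R i))%:E).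
  apply: eq_integral => v _; rewrite patchE; case: ifPn => [/set_mem vB|vB].
    by congr EFin; apply: eq_bigr => i _; rewrite patchE mem_set//; exact: vB.
  have [i nBi] : exists i, ~ B i (v 0%R i).
    by apply/existsNP => h; move/negP: vB; apply; rewrite inE.
  by rewrite (bigD1 i)//= patchE memNset// mul0r.
rewrite (@integral_lebesgue_rV_prod n (fun i => f \_ (B i))); last 2 first.
  move=> i; apply/(measurable_restrictT f (mB i)).
  exact: measurable_funTS.
  by move=> i x; rewrite patchE; case: ifP.
by apply: eq_bigr => i _; apply: eq_integral => x _; rewrite !patchE; case: ifP.
Qed.

(** Lebesgue measure is [s] times its image under x |-> s x, because both give
the same value to intervals. *)
Lemma integral_lebesgue_scale (s : R) (f : R -> R) (B : set R) : (0 < s)%R ->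
  measurable_fun setT f -> (forall x, (0 <= f x)%R) -> measurable B ->
  \int[mu]_(x in B) (f (x / s))%:E =
  s%:E * \int[mu]_(x in [set x | B (s * x)%R]) (f x)%:E.
Proof.
move=> s0 mf f0 mB.
pose h : R -> measurableTypeR R := fun x => (s * x)%R.
have mh : measurable_fun setT h by exact: mulrl_measurable.
pose hM := isMeasurableFun.Build _ _ _ _ h mh.
pose H : {mfun _ >-> _} := HB.pack h hM.
pose k : {nonneg R} := NngNum (ltW s0).
have hE (a b : R) : h @^-1` `]a, b]%classic = `](a / s)%R, (b / s)%R]%classic.
  apply/seteqP; split => x /=; rewrite /h !in_itv/= [(s * x)%R]mulrC => /andP[? ?].
    by rewrite ltr_pdivrMr// ler_pdivlMr//; apply/andP.
  by rewrite -ltr_pdivrMr// -ler_pdivlMr//; apply/andP.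
have muE A : measurable A -> mu A = mscale k (pushforward mu H) A.
  apply: lebesgue_measure_unique => _ [[a b]] _ <-.
  transitivity (s%:E * mu (h @^-1` `]a, b]%classic)); last by [].
  rewrite hE !lebesgue_measure_itv/= !lte_fin.
  rewrite ltr_pM2r ?invr_gt0//; case: ifPn => _; last by rewrite mule0.
  by rewrite -!EFinB -EFinM -mulrBl mulrCA divff ?gt_eqF// mulr1.
rewrite (eq_measure_integral (mscale k (pushforward mu H))); last first.
  by move=> A mA _; exact: muE.
have mfs : measurable_fun B (fun x => (f (x / s))%:E).
  apply/measurable_funTS/measurable_EFinP/measurableT_comp => //.
  exact: mulrr_measurable.
rewrite ge0_integral_mscale//; last by move=> x _; rewrite lee_fin.
rewrite ge0_integral_pushforward//; last by move=> x _; rewrite lee_fin.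
congr (_ * _); apply: eq_integral => x _ /=.
by rewrite /h mulrC mulKf ?gt_eqF.
Qed.

End product_integrals.

(** * Independence and Gaussian momenta *)

Section independent_pairs.
Context {R : realType}.

Lemma independent_pair_law dT (T : measurableType dT) (P : probability T R)
    d1 d2 (T1 : measurableType d1) (T2 : measurableType d2)
    (X : {RV P >-> T1}) (Y : {RV P >-> T2}) (C : set (T1 * T2)) :
  independent_rv X Y -> measurable C ->
  P [set w | C (X w, Y w)] = (distribution P X \x distribution P Y)%E C.
Proof.
move=> indep mC.
have mXY : measurable_fun setT (fun w => (X w, Y w)).
  exact: measurable_fun_pair.
pose XYm := isMeasurableFun.Build _ _ _ _ _ mXY.
pose XY : {RV P >-> (T1 * T2)%type} := HB.pack (fun w => (X w, Y w)) XYm.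
by rewrite (@product_measure_unique _ _ _ _ _ _ _ (distribution P XY)).
Qed.

(** Both pairs have the product of the same marginals as joint law, whatever the
underlying probability spaces are. *)
Lemma eq_law_of_independent_pair
    d1 (T1 : measurableType d1) (P1 : probability T1 R)
    d2 (T2 : measurableType d2) (P2 : probability T2 R)
    dA dB dC (A : measurableType dA) (B : measurableType dB)
    (C : measurableType dC) (X1 : {RV P1 >-> A}) (Y1 : {RV P1 >-> B})
    (X2 : {RV P2 >-> A}) (Y2 : {RV P2 >-> B})
    (f : A * B -> C) (D : set C) :
  measurable_fun setT f -> measurable D ->
  independent_rv X1 Y1 -> independent_rv X2 Y2 ->
  (forall E, measurable E -> distribution P1 X1 E = distribution P2 X2 E) ->
  (forall E, measurable E -> distribution P1 Y1 E = distribution P2 Y2 E) ->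
  P1 [set w | D (f (X1 w, Y1 w))] = P2 [set w | D (f (X2 w, Y2 w))].
Proof.
move=> mf mD ind1 ind2 eqX eqY.
have mfD : measurable (f @^-1` D) by rewrite -[X in measurable X]setTI; exact: mf.
rewrite (independent_pair_law ind1 mfD) (independent_pair_law ind2 mfD).
apply: product_measure_unique => // E G mE mG.
apply: etrans (product_measure1E _ _ mE mG) _.
by congr (_ * _)%E; [exact/esym/eqX|exact/esym/eqY].
Qed.

End independent_pairs.

Section gaussian_momentum.
Context {R : realType} {n : nat}.
Local Notation X := 'rV[R]_n.
Local Notation gauss := (normal_pdf (0 : R) 1).

(** A standard normal vector scaled by [s] has any law proportional to a
density that is a multiple of the product of the functions v_i |-> gauss (v_i /
s): on boxes the two laws differ by the factor c C s^n, and this factor is 1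
because the whole space is a box of mass 1 for both. *)
Lemma gaussian_momentum_law (s C c : R) (nu : X -> R)
    d1 (T1 : measurableType d1) (P1 : probability T1 R)
    d2 (T2 : measurableType d2) (P2 : probability T2 R)
    (xi sxi : {RV P1 >-> X}) (p : {RV P2 >-> X}) :
  0 < s -> 0 <= C ->
  (forall v, nu v = C * \prod_(i < n) gauss (v 0 i / s)) ->
  standard_normal_rv xi -> (forall w, sxi w = s *: xi w) ->
  (forall E, measurable E ->
    distribution P2 p E = (c%:E * \int[lebesgue_rV n]_(v in E) (nu v)%:E)%E) ->
  forall E, measurable E -> distribution P1 sxi E = distribution P2 p E.
Proof.
move=> s0 C0 nuE xiN sxiE pE.
have mg := @measurable_normal_pdf R 0 1.
have g0 := @normal_pdf_ge0 R 0 1.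
have mgs : measurable_fun setT (fun x : R => gauss (x / s)).
  by apply: measurableT_comp => //; exact: mulrr_measurable.
have law1 B : (forall i, measurable (B i)) -> distribution P1 sxi (box B) =
    (\prod_(i < n) normal_prob (0 : R) 1 [set x : R | B i (s * x)%R])%E.
  move=> mB; rewrite -(xiN (fun i => [set x : R | B i (s * x)])); last first.
    move=> i; rewrite -[X in measurable X]setTI.
    exact: (mulrl_measurable s measurableT (mB i)).
  rewrite /distribution /pushforward; congr (P1 _); apply/seteqP.
  by split=> w /= h i; have := h i; rewrite sxiE mxE.
have law2 B : (forall i, measurable (B i)) -> distribution P2 p (box B) =
    ((c * C * s ^+ n)%:E * distribution P1 sxi (box B))%E.
  move=> mB; rewrite law1// pE; last exact: measurable_box.
  under eq_integral do rewrite nuE EFinM.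
  rewrite (ge0_integralZl _ (measurable_box mB))//=; last 2 first.
  - apply/measurable_EFinP/measurable_funTS.
    exact: (@measurable_prod_coord _ _ (fun _ x => gauss (x / s))).
  - by move=> v _; rewrite lee_fin prodr_ge0.
  rewrite (@integral_lebesgue_rV_box _ _ (fun x => gauss (x / s)))//.
  rewrite muleA -EFinM [in RHS]EFinM -muleA; congr (_ * _)%E.
  rewrite (eq_bigr (fun i => s%:E * normal_prob (0 : R) 1
      [set x : R | B i (s * x)%R])%E); last first.
    by move=> i _; exact: (integral_lebesgue_scale s0 mg g0 (mB i)).
  rewrite big_split/=; congr (_ * _)%E.
  by rewrite -(big_morph EFin EFinM erefl) prodr_const card_ord.
have k1 : c * C * s ^+ n = 1.
  have boxT : box (fun _ : 'I_n => setT) = [set: X] by apply/seteqP; split.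
  have := law2 (fun=> setT) (fun=> measurableT); rewrite boxT.
  rewrite !probability_setT mule1 => -[].
  by [].
apply: finite_measure_rV_unique.
  exact: (le_lt_trans (probability_le1 (distribution P1 sxi) measurableT) (ltry 1)).
by move=> B mB; apply/esym; apply: etrans (law2 _ mB) _; rewrite k1 mul1e.
Qed.

End gaussian_momentum.

(** * Equality of the acceptance probabilities *)

Section mala_is_hmc.
Context {R : realType} {d : nat}.
Variables (n : nat) (beta S dt : R) (xm xp : 'rV[R]_d) (V : 'rV[R]_d -> R) (Z : R).
Hypotheses (d_gt0 : (0 < d)%N) (n_gt0 : (0 < n)%N) (beta_gt0 : 0 < beta).
Hypotheses (S_gt0 : 0 < S) (dt_gt0 : 0 < dt) (Z_gt0 : 0 < Z).
Hypothesis smoothV : continuously_differentiable 4 V.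
Local Notation X := 'rV[R]_(d * n.-1).
Local Notation dtau := (Num.sqrt (2 * dt)).
Local Notation nu := (nu_extended n beta S xm xp V Z).
Local Notation Phi := (phi n beta S xm xp V dtau).
Local Notation gradG := (grad (calG beta S xm xp V)).

Let ds_gt0 : 0 < ds n S.
Proof. by rewrite divr_gt0// ltr0n. Qed.

Let dtau2 : dtau ^+ 2 = 2 * dt.
Proof. by rewrite sqr_sqrtr// mulr_ge0// ltW. Qed.

Lemma phi_volume_preserving (t : R) : volume_preserving (phi n beta S xm xp V t).
Proof.
rewrite (funext (@phiE R d n beta S xm xp V t)).
have vK : volume_preserving (kick t gradG : X * X -> X * X).
  by apply: kick_volume_preserving => u; exact: differentiable_grad_calG.
have vC := cayley_volume_preserving (phi_minus_unit n S t d_gt0).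
exact: volume_preserving_comp (volume_preserving_comp vK vC) vK.
Qed.

Lemma mala_half_A : mala_A n S dt 2^-1 = phi_minus d n S dtau.
Proof. by rewrite /mala_A /phi_minus dtau2; congr (_ - _ *: _); field. Qed.

Lemma mala_half_B : mala_B n S dt 2^-1 = phi_plus n S dtau :> 'M[R]_(d * n.-1).
Proof. by rewrite /mala_B /phi_plus dtau2; congr (_ + _ *: _); field. Qed.

(** This is the equation that defines the MALA proposal, with the noise term
written as dtau p. *)
Lemma phi_position (u p : X) :
  mulmv (phi_minus d n S dtau) (Phi (u, p)).1 =
  mulmv (phi_plus n S dtau) u + dt *: F beta S xm xp V u + dtau *: p.
Proof.
rewrite /phi /= mulmvVK; last exact: phi_minus_unit.
rewrite dtau2 grad_calG// scalerN opprK addrAC; congr (_ + _ *: _ + _).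
by field.
Qed.

Lemma mala_q_phi (u p : X) :
  mala_q beta S xm xp V dt 2^-1 u (Phi (u, p)).1 =
  expR (- (beta * ds n S / 4) * dotv p p).
Proof.
rewrite /mala_q mala_half_A mala_half_B phi_position.
have -> (a b c : X) : a + b + c - a - b = c.
  by apply/rowP => i; rewrite !mxE; ring.
rewrite dotvZ dtau2 mulrA; congr expR; congr (_ * _).
by move: (ds n S) => h; field; rewrite gt_eqF.
Qed.

(** Reversibility exhibits [u] as the position of the image under phi of the
flipped endpoint, so the backward transition density is a forward one. *)
Lemma mala_q_phi_back (u p : X) :
  mala_q beta S xm xp V dt 2^-1 (Phi (u, p)).1 u =
  expR (- (beta * ds n S / 4) * dotv (Phi (u, p)).2 (Phi (u, p)).2).
Proof.
have := @phi_reversible R d n beta S xm xp V dtau d_gt0 (u, p).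
rewrite /= /momentum_flip => back.
have := mala_q_phi (Phi (u, p)).1 (- (Phi (u, p)).2).
by rewrite back /= dotvN.
Qed.

(** The kinetic part of the Boltzmann weight is the Gaussian that appears in the
proposal density, and the potential part is the target density. *)
Lemma boltzmann_weightE (z : X * X) :
  boltzmann_weight n beta S xm xp V z =
  expR (- (beta * ds n S / 4) * dotv z.2 z.2) * target_density beta S xm xp V z.1.
Proof.
rewrite /boltzmann_weight /target_density /hamiltonian /= -expRD; congr expR.
by move: (ds n S) (calG _ _ _ _ _ _) (dotv _ _) (dotv _ _) => h g a b; field.
Qed.

Lemma mala_alpha_phi (u p : X) :
  mala_alpha beta S xm xp V dt 2^-1 u (Phi (u, p)).1 =
  Num.min 1 (nu (Phi (u, p)) / nu (u, p)).
Proof.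
rewrite /mala_alpha mala_q_phi mala_q_phi_back /nu_extended.
rewrite !boltzmann_weightE [(u, p).1]/= [(u, p).2]/=.
by rewrite -[in RHS]mulf_div divff ?mul1r// invr_eq0 gt_eqF.
Qed.

End mala_is_hmc.

(** * Measurability of the step *)

Lemma differentiable_dotv (R : realType) (W : normedModType R) m
    (f g : W -> 'rV[R]_m) x :
  differentiable f x -> differentiable g x ->
  differentiable (fun y => dotv (f y) (g y)) x.
Proof.
move=> df dg.
rewrite (_ : (fun _ => _) =
    \sum_(i < m) ((fun y => f y 0 i) * (fun y => g y 0 i))); last first.
  by apply/funext => y; rewrite fct_sumE.
by apply: differentiable_sum => i; apply: differentiableM; exact: differentiable_coordE.
Qed.

Section acceptance.
Context {R : realType} {d : nat}.
Variables (n : nat) (beta S dt : R) (xm xp : 'rV[R]_d) (V : 'rV[R]_d -> R) (Z : R).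
Hypotheses (d_gt0 : (0 < d)%N) (n_gt0 : (0 < n)%N) (beta_gt0 : 0 < beta).
Hypotheses (S_gt0 : 0 < S) (dt_gt0 : 0 < dt) (Z_gt0 : 0 < Z).
Hypothesis smoothV : continuously_differentiable 4 V.
Local Notation X := 'rV[R]_(d * n.-1).
Local Notation dtau := (Num.sqrt (2 * dt)).
Local Notation nu := (nu_extended n beta S xm xp V Z).
Local Notation Phi := (phi n beta S xm xp V dtau).

Lemma differentiable_hamiltonian (f g : X -> X) x :
  differentiable f x -> differentiable g x ->
  differentiable (fun y => hamiltonian beta S xm xp V (f y, g y)) x.
Proof.
move=> df dg.
have dLf : differentiable (fun y => mulmv (L n S) (f y)) x.
  exact: (@differentiable_comp _ _ _ _ f (mulmxr (L n S)^T) x df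
    (differentiable_mulmxr _ _)).
have dGf : differentiable (fun y => calG beta S xm xp V (f y)) x.
  exact: (@differentiable_comp _ _ _ _ f (calG beta S xm xp V) x df
    (differentiable_calG _ _ _ _ smoothV _)).
have d1 := differentiableZ 2^-1 (differentiable_dotv dg dg).
have d2 := differentiableZ 2^-1 (differentiable_dotv df dLf).
exact: (differentiableD (differentiableB d1 d2) dGf).
Qed.

Lemma differentiable_row_mx (u : X) x :
  differentiable (fun p : X => row_mx u p : 'rV_(d * n.-1 + d * n.-1)) x.
Proof.
rewrite (_ : (fun _ => _) =
    fun p : X => mulmxr (row_mx 0 1%:M) p + row_mx u 0).
  by apply: differentiable_addcst; exact: differentiable_mulmxr.
by apply/funext => p /=; rewrite mul_mx_row mulmx0 mulmx1 add_row_mx add0r addr0.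
Qed.

Let flat_phi (u p : X) := flat_map Phi (row_mx u p).

Let differentiable_flat_phi u p : differentiable (flat_phi u) p.
Proof.
apply: (@differentiable_comp _ _ _ _ (fun p : X => row_mx u p) (flat_map Phi)).
  exact: differentiable_row_mx.
by have [] := @phi_volume_preserving R d n beta S xm xp V d_gt0 smoothV dtau
  (row_mx u p).
Qed.

Lemma differentiable_phi1 (u p : X) : differentiable (fun p => (Phi (u, p)).1) p.
Proof.
apply: differentiable_rV => i.
rewrite (_ : (fun _ => _) = fun p => flat_phi u p 0 (lshift _ i)).
  exact: differentiable_coordE.
by apply/funext => v; rewrite /flat_phi /flat_map row_mxEl row_mxKl row_mxKr.
Qed.

Lemma differentiable_phi2 (u p : X) : differentiable (fun p => (Phi (u, p)).2) p.
Proof.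
apply: differentiable_rV => i.
rewrite (_ : (fun _ => _) = fun p => flat_phi u p 0 (rshift _ i)).
  exact: differentiable_coordE.
by apply/funext => v; rewrite /flat_phi /flat_map row_mxEr row_mxKl row_mxKr.
Qed.

(** The ratio is the exponential of a difference of Hamiltonians, which is
differentiable in p along phi because phi itself is. *)
Lemma continuous_nu_ratio (u : X) :
  continuous (fun p : X => nu (Phi (u, p)) / nu (u, p) : R).
Proof.
pose h p := hamiltonian beta S xm xp V ((Phi (u, p)).1, (Phi (u, p)).2).
pose k p := hamiltonian beta S xm xp V (u, p).
rewrite (_ : (fun p => _) = expR \o (fun p => - (beta / 2) * ds n S * (h p - k p))).
  move=> p; apply: continuous_comp; last exact: continuous_expR.
  apply: differentiable_continuous.
  apply: (@differentiableZ _ _ _ (fun p => h p - k p)).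
  apply: differentiableB; apply: differentiable_hamiltonian.
  - exact: differentiable_phi1.
  - exact: differentiable_phi2.
  - exact: differentiable_cst.
  - exact: ex_diff.
apply/funext => p; rewrite /nu_extended /boltzmann_weight /=.
rewrite -mulf_div divff ?mul1r ?invr_eq0 ?gt_eqF// mulrBr expRD expRN.
by rewrite /h -surjective_pairing.
Qed.

(** One step from [u] as a function of the momentum [z.1] and of the uniform
variable [z.2]. *)
Definition metropolis_map (u : X) (z : X * R) : X :=
  if z.2 <= Num.min 1 (nu (Phi (u, z.1)) / nu (u, z.1))
  then (Phi (u, z.1)).1 else u.

Lemma measurable_metropolis_map u : measurable_fun setT (metropolis_map u).
Proof.
have mPhi : measurable_fun setT (fun p : X => (Phi (u, p)).1).
  apply: measurable_fun_coordP => i; apply: continuous_measurable_rV => p.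
  apply: differentiable_continuous; apply: differentiable_coordE.
  exact: differentiable_phi1.
have mr := continuous_measurable_rV (@continuous_nu_ratio u).
apply: measurable_fun_ifT.
- apply: measurable_fun_ler => //.
  apply: measurable_minr => //.
  exact: (measurableT_comp mr (@measurable_fst _ _ X R)).
- exact: (measurableT_comp mPhi (@measurable_fst _ _ X R)).
- exact: measurable_cst.
Qed.

End acceptance.

(** * Equality in law *)

Section one_step.
Context {R : realType} {d : nat}.
Variables (n : nat) (beta S dt : R) (xm xp : 'rV[R]_d) (V : 'rV[R]_d -> R) (Z : R).
Hypotheses (d_gt0 : (0 < d)%N) (n_gt0 : (0 < n)%N) (beta_gt0 : 0 < beta).
Hypotheses (S_gt0 : 0 < S) (dt_gt0 : 0 < dt) (Z_gt0 : 0 < Z).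
Hypothesis smoothV : continuously_differentiable 4 V.
Local Notation X := 'rV[R]_(d * n.-1).
Local Notation dtau := (Num.sqrt (2 * dt)).
Local Notation nu := (nu_extended n beta S xm xp V Z).
Local Notation Phi := (phi n beta S xm xp V dtau).

(** The standard deviation of each momentum coordinate under the Boltzmann
weight exp (- (beta ds / 4) |p|^2). *)
Definition noise_scale : R := Num.sqrt (2 / (beta * ds n S)).

Let ds_gt0 : 0 < ds n S.
Proof. by rewrite divr_gt0// ltr0n. Qed.

Lemma noise_scale_gt0 : 0 < noise_scale.
Proof. by rewrite sqrtr_gt0 divr_gt0// mulr_gt0. Qed.

Lemma noise_scale2 : noise_scale ^+ 2 = 2 / (beta * ds n S).
Proof. by rewrite sqr_sqrtr// ltW// divr_gt0// mulr_gt0. Qed.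

(** The squares of both sides are 4 dt / (beta ds). *)
Lemma dtau_noise_scale :
  dtau * noise_scale = 2 * Num.sqrt beta^-1 * Num.sqrt (dt / ds n S).
Proof.
apply: (@pexpIrn _ 2) => //; rewrite ?nnegrE.
- by rewrite mulr_ge0// sqrtr_ge0.
- by rewrite !mulr_ge0// sqrtr_ge0.
rewrite !exprMn noise_scale2 !sqr_sqrtr ?mulr_ge0 ?divr_ge0 ?invr_ge0//; try exact: ltW.
by move: (ds n S) ds_gt0 => h h0; field; rewrite !gt_eqF.
Qed.

Lemma nu_gaussian (u p : X) :
  nu (u, p) =
  Z^-1 * target_density beta S xm xp V u / normal_peak 1 ^+ (d * n.-1) *
  \prod_(i < d * n.-1) normal_pdf 0 1 (p 0 i / noise_scale).
Proof.
rewrite /nu_extended boltzmann_weightE /=.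
under eq_bigr do rewrite normal_pdfE ?oner_eq0//.
rewrite big_split/= prodr_const card_ord.
have peak0 : normal_peak (1 : R) ^+ (d * n.-1) != 0.
  by rewrite expf_neq0// gt_eqF// normal_peak_gt0// oner_eq0.
rewrite [RHS]mulrA divfK// -[RHS]mulrA [X in _ = _ * X]mulrC; congr (_ * (_ * _)).
rewrite /normal_fun -expR_sum; congr expR; rewrite /dotv mulr_sumr.
apply: eq_bigr => i _; rewrite subr0 expr_div_n noise_scale2.
by move: (ds n S) ds_gt0 => h h0; field; rewrite !gt_eqF.
Qed.

(** With the momentum [noise_scale *: xi] the MALA step becomes
[metropolis_map], as is the HMC step with the momentum [p]. *)
Lemma mala_hmc_same_law (u0 : X)
    d1 (T1 : measurableType d1) (P1 : probability T1 R) (u1 : {RV P1 >-> X})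
    d2 (T2 : measurableType d2) (P2 : probability T2 R) (u1' : {RV P2 >-> X}) :
  mala_step n beta S xm xp V dt 2^-1 P1 u0 u1 ->
  hmc_step nu Phi P2 u0 u1' ->
  forall A, measurable A -> distribution P1 u1 A = distribution P2 u1' A.
Proof.
move=> [xi [U [ut [xiN Uu indep utE u1E]]]].
move=> [p [U' [[c pE] Uu' indep' u1'E]]] A mA.
have mscale : measurable_fun setT (fun w => noise_scale *: xi w).
  apply: measurable_fun_coordP => i.
  rewrite (_ : (fun _ => _) = fun w => noise_scale * xi w 0 i); last first.
    by apply/funext => w; rewrite mxE.
  apply: measurable_funM => //.
  exact: (measurableT_comp (measurable_coord i) (measurable_funP xi)).
pose sxiM := isMeasurableFun.Build _ _ _ _ _ mscale.
pose sxi : {RV P1 >-> X} := HB.pack (fun w => noise_scale *: xi w) sxiM.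
have indep_s : independent_rv sxi U.
  move=> E G mE mG.
  apply: (indep ((fun v => noise_scale *: v) @^-1` E) G) => //.
  rewrite -[X in measurable X]setTI.
  have ms : measurable_fun setT (fun v : X => noise_scale *: v).
    apply: measurable_fun_coordP => i.
    rewrite (_ : (fun _ => _) = fun v : X => noise_scale * v 0 i); last first.
      by apply/funext => w; rewrite mxE.
    by apply: measurable_funM => //; exact: measurable_coord.
  exact: ms.
have utP w : ut w = (Phi (u0, noise_scale *: xi w)).1.
  apply: (can_inj (mulmvK (phi_minus_unit n S dtau d_gt0))).
  rewrite phi_position// -mala_half_A// utE mala_half_B// scalerA dtau_noise_scale.
  by [].
pose f := metropolis_map beta S dt xm xp V Z u0.
have stepE : u1 =1 fun w => f (sxi w, U w).
  by move=> w; rewrite u1E utP (@mala_alpha_phi R d n beta S dt xm xp V Z).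
have step'E : u1' =1 fun w => f (p w, U' w).
  by move=> w; rewrite u1'E.
transitivity (P1 [set w | A (f (sxi w, U w))]).
  by congr (P1 _); apply/seteqP; split=> w /=; rewrite stepE.
transitivity (P2 [set w | A (f (p w, U' w))]);
    last first.
  by congr (P2 _); apply/seteqP; split=> w /=; rewrite step'E.
apply: eq_law_of_independent_pair => //.
- exact: measurable_metropolis_map.
- apply: (gaussian_momentum_law noise_scale_gt0 _ (nu_gaussian u0) xiN _ pE) => //.
  by rewrite !mulr_ge0 ?invr_ge0 ?exprn_ge0 ?normal_peak_ge0 ?expR_ge0 ?ltW.
- by move=> E mE; rewrite Uu// Uu'.
Qed.

End one_step.

Theorem proposition4p1 (R : realType) (d n : nat) (beta S dt : R)
  (xm xp : 'rV[R]_d) (V : 'rV[R]_d -> R) (Z : R)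
  (hd : (1 <= d)%N) (hn : (2 <= n)%N)
  (hbeta : 0 < beta) (hS : 0 < S) (hdt : 0 < dt)
  (hV : continuously_differentiable 4 V)
  (hZ : is_normalization_constant (boltzmann_weight n beta S xm xp V) Z) :
  let dtau := Num.sqrt (2 * dt) in
  let nu := nu_extended n beta S xm xp V Z in
  let phi_dtau := phi n beta S xm xp V dtau in
  [/\ phi_minus d n S dtau \in unitmx,
      volume_preserving phi_dtau,
      reversible phi_dtau &
      forall (u0 : 'rV[R]_(d * n.-1))
        (d1 : measure_display) (T1 : measurableType d1) (P1 : probability T1 R)
        (u1 : {RV P1 >-> 'rV[R]_(d * n.-1)})
        (d2 : measure_display) (T2 : measurableType d2) (P2 : probability T2 R)
        (u1' : {RV P2 >-> 'rV[R]_(d * n.-1)}),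
      mala_step n beta S xm xp V dt 2^-1 P1 u0 u1 ->
      hmc_step nu phi_dtau P2 u0 u1' ->
      forall A : set 'rV[R]_(d * n.-1), measurable A ->
        distribution P1 u1 A = distribution P2 u1' A].
Proof.
move=> dtau nu phi_dtau; have Z_gt0 : 0 < Z by case: hZ.
split.
- exact: phi_minus_unit.
- exact: phi_volume_preserving.
- exact: phi_reversible.
- move=> u0 d1 T1 P1 u1 d2 T2 P2 u1' mala hmc.
  exact: (mala_hmc_same_law hd (ltnW hn) hbeta hS hdt Z_gt0 hV mala hmc).
Qed.
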